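(* Let $K$ be an algebraically closed field of characteristic $p=2$, and let $n$ be a positive integer with $2\nmid n$. Then the $a$-number of the Fermat curve $\mathcal{F}_n$ over $K$ is $$a(\mathcal{F}_n)=\tfrac18\,(n^2-1).$$
   Context: For a positive integer $n$ with $p\nmid n$, the Fermat curve $\mathcal{F}_n$ is the nonsingular projective plane curve over $K$ with affine equation $X^n+Y^n+1=0$. For a (projective, irreducible, nonsingular) curve $\mathcal{X}$ over $K$ with separating variable $x$ (i.e. $x\in K(\mathcal{X})\setminus K(\mathcal{X})^p$), every $f\in K(\mathcal{X})$ is uniquely $f=u_0^p+u_1^px+\dots+u_{p-1}^px^{p-1}$ with $u_i\in K(\mathcal{X})$; the Cartier operator is the $1/p$-linear map $\mathcal{C}(f\,dx)=u_{p-1}\,dx$ on differentials (it does not depend on $x$). It maps the $g$-dimensional $K$-space $H^0(\mathcal{X},\Omega^1)$ of holomorphic differentials into itself, where $g$ is the genus. The $a$-number $a(\mathcal{X})$ is the $K$-dimension of the kernel of $\mathcal{C}$ on $H^0(\mathcal{X},\Omega^1)$, equivalently the dimension of the space of exact holomorphic differentials (those of the form $df$, $f\in K(\mathcal{X})$). *)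

(* Defs.v *)
From HB Require Import structures.
From mathcomp Require Import all_boot all_order all_algebra.
From mathcomp Require Export mpoly.

Set Implicit Arguments.
Unset Strict Implicit.
Unset Printing Implicit Defensive.

Import GRing.Theory.
Local Open Scope ring_scope.

(* The projective closure of X^n + Y^n + 1 = 0. *)
Definition fermat_form (K : fieldType) (n : nat) : {mpoly K[3]} :=
  \sum_(i < 3) 'X_i ^+ n.

Definition curve_point (K : fieldType) (G : {mpoly K[3]}) (v : 'I_3 -> K) : Prop :=
  (exists i, v i != 0) /\ G.@[v] = 0.

(* F is the function field of the plane projective curve G = 0, and xi is a
   triple of homogeneous coordinates of its generic point: F consists of the
   fractions A / B of forms of equal degree with B not divisible by G, and a
   form vanishes on the curve exactly when G divides it.  This determines
   (F, iota) up to isomorphism, and xi up to that isomorphism and scaling. *)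
Definition is_function_field (K F : fieldType) (iota : {rmorphism K -> F})
    (G : {mpoly K[3]}) (xi : 'I_3 -> F) : Prop :=
  (forall (e : nat) (A : {mpoly K[3]}), A \is e.-homog ->
     (mmap iota xi A = 0 <-> exists Q : {mpoly K[3]}, A = Q * G)) /\
  (forall f : F, exists (e : nat) (A B : {mpoly K[3]}),
     [/\ A \is e.-homog, B \is e.-homog, mmap iota xi B != 0
       & f = mmap iota xi A / mmap iota xi B]).

Definition is_derivation (K F : fieldType) (iota : {rmorphism K -> F})
    (M : lmodType F) (D : F -> M) : Prop :=
  [/\ forall f g, D (f + g) = D f + D g,
      forall f g, D (f * g) = f *: D g + g *: D f
    & forall c, D (iota c) = 0].

(* (Om, d) is the module of Kaehler differentials of F / K. *)
Definition is_kaehler (K F : fieldType) (iota : {rmorphism K -> F})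
    (Om : lmodType F) (d : F -> Om) : Prop :=
  is_derivation iota d /\
  (forall (M : lmodType F) (D : F -> M), is_derivation iota D ->
     exists phi : {linear Om -> M},
       (forall f, D f = phi (d f)) /\
       (forall psi : {linear Om -> M},
          (forall f, D f = psi (d f)) -> forall w, psi w = phi w)).

(* f belongs to the local ring at v, a point of the curve G = 0; since
   B does not vanish at v, G does not divide B and B(xi) is nonzero. *)
Definition regular_function_at (K F : fieldType) (iota : {rmorphism K -> F})
    (xi : 'I_3 -> F) (v : 'I_3 -> K) (f : F) : Prop :=
  exists (e : nat) (A B : {mpoly K[3]}),
    [/\ A \is e.-homog, B \is e.-homog, B.@[v] != 0
      & f = mmap iota xi A / mmap iota xi B].

Definition regular_differential_at (K F : fieldType)
    (iota : {rmorphism K -> F}) (xi : 'I_3 -> F) (Om : lmodType F)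
    (d : F -> Om) (v : 'I_3 -> K) (w : Om) : Prop :=
  exists (m : nat) (f g : 'I_m -> F),
    [/\ forall i, regular_function_at iota xi v (f i),
        forall i, regular_function_at iota xi v (g i)
      & w = \sum_(i < m) f i *: d (g i)].

Definition holomorphic (K F : fieldType) (iota : {rmorphism K -> F})
    (G : {mpoly K[3]}) (xi : 'I_3 -> F) (Om : lmodType F) (d : F -> Om)
    (w : Om) : Prop :=
  forall v, curve_point G v -> regular_differential_at iota xi d v w.

Definition separating (p : nat) (F : fieldType) (t : F) : Prop :=
  ~ exists u : F, t = u ^+ p.

(* The graph of the Cartier operator, w' = C(w); the value does not depend on
   the choice of t. *)
Definition cartier (p : nat) (F : fieldType) (Om : lmodType F) (d : F -> Om)
    (w w' : Om) : Prop :=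
  exists (t : F) (u : nat -> F),
    [/\ separating p t,
        w = (\sum_(i < p) u i ^+ p * t ^+ i) *: d t
      & w' = u p.-1 *: d t].

(* K acts on the F-space Om through iota. *)
Definition has_dimension (K F : fieldType) (iota : {rmorphism K -> F})
    (Om : lmodType F) (V : Om -> Prop) (a : nat) : Prop :=
  exists b : 'I_a -> Om,
    (forall c : 'I_a -> K, \sum_(i < a) iota (c i) *: b i = 0 ->
       forall i, c i = 0) /\
    (forall w, V w <-> exists c : 'I_a -> K, w = \sum_(i < a) iota (c i) *: b i).

Definition has_a_number (p : nat) (K F : fieldType)
    (iota : {rmorphism K -> F}) (G : {mpoly K[3]}) (xi : 'I_3 -> F)
    (Om : lmodType F) (d : F -> Om) (a : nat) : Prop :=
  has_dimension iota
    (fun w => holomorphic iota G xi d w /\ cartier p d w 0) a.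

(* Main.v *)
(** Put [M = (n - 1) / 2], [x = xi_i / xi_k], [y = xi_j / xi_k] and
    [omega = dx / y^(2 M)], a generator of the regular differentials at
    every affine point.  Every element of [F] is
    [u^2 + v^2 x] because [y^n = 1 + x^n] with [n] odd, so the differentials
    killed by the Cartier operator are exactly the [g^2 omega].  Such a
    differential is regular at an affine point iff [g^2] is, and regularity at
    all affine points forces [g] to be a polynomial in [x] and [y] of
    [y]-degree less than [n]: a root [a] of a denominator in [K[x]] can be
    cancelled, since the numerator vanishes at the [n] points over [a], or to
    order [n] at the unique point over [a] when [a^n = 1].  Comparing the
    expansions of [g] in the charts [xi_k <> 0] and [xi_i <> 0] bounds the total
    degree by [M - 1].  Since squaring is additive and [K] is perfect, the
    [x^(2 l) y^(2 m) omega] with [l + m < M] form a basis, and there are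
    [M (M + 1) / 2 = (n^2 - 1) / 8] of them. *)

Require Import Defs.
From HB Require Import structures.
From mathcomp Require Import all_boot all_order all_algebra.
From mathcomp Require Import mpoly.
From mathcomp Require Import separable ring.

Set Implicit Arguments.
Unset Strict Implicit.
Unset Printing Implicit Defensive.

Import GRing.Theory.
Local Open Scope ring_scope.

(** * Affine models *)

Section Evaluation.

Variables (K L : fieldType) (f : {rmorphism K -> L}).

(* [{poly {poly K}}] is read as [K[X][Y]]: the inner variable is sent to [x] and
   the outer one to [y]. *)
Definition eval2 (x y : L) : {poly {poly K}} -> L :=
  horner_eval x \o (horner_eval y%:P \o map_poly (map_poly f)).

HB.instance Definition _ (x y : L) := GRing.RMorphism.copy (eval2 x y)
  (horner_eval x \o (horner_eval y%:P \o map_poly (map_poly f))).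

Lemma eval2E x y P : eval2 x y P = (map_poly (map_poly f) P).[y%:P].[x].
Proof. by []. Qed.

Lemma eval2_0 x y : eval2 x y 0 = 0. Proof. exact: rmorph0. Qed.

Lemma eval2_1 x y : eval2 x y 1 = 1. Proof. exact: rmorph1. Qed.

Lemma eval2D x y P Q : eval2 x y (P + Q) = eval2 x y P + eval2 x y Q.
Proof. exact: (rmorphD (eval2 x y)). Qed.

Lemma eval2B x y P Q : eval2 x y (P - Q) = eval2 x y P - eval2 x y Q.
Proof. exact: (rmorphB (eval2 x y)). Qed.

Lemma eval2N x y P : eval2 x y (- P) = - eval2 x y P.
Proof. exact: (rmorphN (eval2 x y)). Qed.

Lemma eval2M x y P Q : eval2 x y (P * Q) = eval2 x y P * eval2 x y Q.
Proof. exact: (rmorphM (eval2 x y)). Qed.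

Lemma eval2_exp x y P m : eval2 x y (P ^+ m) = eval2 x y P ^+ m.
Proof. exact: (rmorphXn (eval2 x y)). Qed.

Lemma eval2X x y : eval2 x y 'X = y.
Proof. by rewrite eval2E map_polyX hornerX hornerC. Qed.

Lemma eval2C x y p : eval2 x y p%:P = (map_poly f p).[x].
Proof. by rewrite eval2E map_polyC hornerC. Qed.

Lemma eval2_const x y c : eval2 x y c%:P%:P = f c.
Proof. by rewrite eval2C map_polyC hornerC. Qed.

Lemma eval2_innerX x y : eval2 x y 'X%:P = x.
Proof. by rewrite eval2C map_polyX hornerX. Qed.

Lemma eval2_sum x y P :
  eval2 x y P = \sum_(j < size P) (map_poly f P`_j).[x] * y ^+ j.
Proof.
rewrite -[P in LHS]coefK poly_def rmorph_sum /=; apply: eq_bigr => j _.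
by rewrite -mul_polyC eval2M eval2_exp eval2C eval2X.
Qed.

End Evaluation.

(** * Substitution into multivariate polynomials *)

Section MpolyMap.

Lemma rmorph_mmap (k : nat) (R S T : comNzRingType) (f : {rmorphism R -> S})
    (g : {rmorphism S -> T}) (h : 'I_k -> S) (A : {mpoly R[k]}) :
  g (mmap f h A) = mmap (g \o f) (g \o h) A.
Proof.
rewrite /mmap rmorph_sum; apply: eq_bigr => m _; rewrite rmorphM /mmap1.
by rewrite rmorph_prod; congr (_ * _); apply: eq_bigr => i _; rewrite rmorphXn.
Qed.

Lemma eq_mmap (k : nat) (R S : comNzRingType) (f f' : R -> S)
    (h h' : 'I_k -> S) (A : {mpoly R[k]}) :
  f =1 f' -> h =1 h' -> mmap f h A = mmap f' h' A.
Proof.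
move=> ff hh; rewrite /mmap /mmap1; apply: eq_bigr => m _; rewrite ff.
by congr (_ * _); apply: eq_bigr => i _; rewrite hh.
Qed.

Lemma mmap_scale (k : nat) (R S : comNzRingType) (f : {rmorphism R -> S})
    (h : 'I_k -> S) (c : S) (e : nat) (A : {mpoly R[k]}) :
  A \is e.-homog -> mmap f (fun i => c * h i) A = c ^+ e * mmap f h A.
Proof.
move=> /dhomogP homA; rewrite /mmap mulr_sumr big_seq [RHS]big_seq.
apply: eq_bigr => m mA; rewrite mulrCA; congr (_ * _).
rewrite /mmap1 -(homA m mA) /= mdegE -prodrXr -big_split.
by apply: eq_bigr => i _; rewrite exprMn.
Qed.

End MpolyMap.

(** * Dehomogenization on a standard chart *)

Section Chart.

Variables (i j k : 'I_3).
Hypothesis ijk : uniq [:: i; j; k].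

Lemma ord3_cases (l : 'I_3) : [\/ l = i, l = j | l = k].
Proof.
suff: [|| l == i, l == j | l == k].
  by case/or3P=> /eqP ->; [constructor 1 | constructor 2 | constructor 3].
by case: i j k l ijk => [[|[|[|?]]] ?] [[|[|[|?]]] ?] [[|[|[|?]]] ?]
  [[|[|[|?]]] ?].
Qed.

(** The point [(a, b)] of the chart where coordinate [k] is 1. The ring is arbitrary so that one
    definition serves for points over [K] and for substituting the variables of [K[X][Y]]. *)
Definition affine_coord (R : nzRingType) (a b : R) (l : 'I_3) : R :=
  if l == i then a else if l == j then b else 1.

Lemma affine_coordE (R : nzRingType) (a b : R) :
  [/\ affine_coord a b i = a, affine_coord a b j = b & affine_coord a b k = 1].
Proof.
move: ijk; rewrite /= !inE negb_or andbT => /andP[/andP[ij ik] jk].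
rewrite /affine_coord !eqxx !(eq_sym j) (negPf ij) !(eq_sym k).
by rewrite (negPf ik) (negPf jk).
Qed.

Variable K : fieldType.
Implicit Types (A B G : {mpoly K[3]}) (P Q : {poly {poly K}}).

Definition dehom : {mpoly K[3]} -> {poly {poly K}} :=
  mmap (polyC \o polyC) (affine_coord 'X%:P 'X).

HB.instance Definition _ := GRing.RMorphism.copy dehom
  (mmap (polyC \o polyC : {rmorphism K -> {poly {poly K}}})
     (affine_coord 'X%:P 'X)).

Lemma dehomX (l : 'I_3) : dehom 'X_l = affine_coord 'X%:P 'X l.
Proof.
rewrite -(mmap1U (affine_coord 'X%:P 'X)).
exact: (mmapX _ (polyC \o polyC : {rmorphism K -> {poly {poly K}}})).
Qed.

(** Homogeneity pulls [v k] out of all coordinates. The field [L] is free because both points over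
    [K] and the generic point over [F] are used. *)
Lemma eval2_dehom (L : fieldType) (f : {rmorphism K -> L}) (v : 'I_3 -> L)
    (e : nat) A :
  v k != 0 -> A \is e.-homog ->
  mmap f v A = v k ^+ e * eval2 f (v i / v k) (v j / v k) (dehom A).
Proof.
move=> vk0 homA.
rewrite /dehom.
rewrite (rmorph_mmap (polyC \o polyC : {rmorphism K -> {poly {poly K}}})).
rewrite -(mmap_scale _ _ _ homA); apply: eq_mmap => [c | l] /=.
  by rewrite eval2_const.
have [Ei Ej Ek] := affine_coordE ('X%:P : {poly {poly K}}) 'X.
by case: (ord3_cases l) => ->; rewrite ?Ei ?Ej ?Ek ?eval2X ?eval2_innerX
  ?rmorph1 ?mulr1 // mulrC divfK.
Qed.

Lemma dehom_surj P : exists e, exists2 A, A \is e.-homog & dehom A = P.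
Proof.
have [Ei Ej Ek] := affine_coordE ('X%:P : {poly {poly K}}) 'X.
have homX l : ('X_l : {mpoly K[3]}) \is 1.-homog by rewrite dhomogX /= mdeg1.
(* Every large degree is claimed so that two summands can share a degree; padding is by powers of
   ['X_k], which dehomogenize to 1. *)
suff: exists N, forall e, (N <= e)%N -> exists2 A, A \is e.-homog & dehom A = P.
  by case=> N /(_ N (leqnn N)) PN; exists N.
have addC P1 P2 :
    (exists N, forall e, (N <= e)%N ->
       exists2 A, A \is e.-homog & dehom A = P1) ->
    (exists N, forall e, (N <= e)%N ->
       exists2 A, A \is e.-homog & dehom A = P2) ->
    exists N, forall e, (N <= e)%N ->
      exists2 A, A \is e.-homog & dehom A = P1 + P2.
  move=> [N1 H1] [N2 H2]; exists (maxn N1 N2) => e.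
  rewrite geq_max => /andP[/H1[A1 hA1 <-] /H2[A2 hA2 <-]].
  by exists (A1 + A2); rewrite ?rmorphD // rpredD.
have mulC l P1 :
    (exists N, forall e, (N <= e)%N ->
       exists2 A, A \is e.-homog & dehom A = P1) ->
    exists N, forall e, (N <= e)%N ->
      exists2 A, A \is e.-homog & dehom A = P1 * dehom 'X_l.
  move=> [N HN]; exists N.+1 => -[//|e] /HN[A hA <-].
  exists (A * 'X_l); rewrite ?rmorphM //.
  by have := dhomogM hA (homX l); rewrite addn1.
elim/poly_ind: P => [|P c IH].
  by exists 0 => e _; exists 0; rewrite ?rmorph0 // dhomog0.
apply: (addC _ _); first by move/(mulC j): IH; rewrite dehomX Ej.
elim/poly_ind: c => [|c a IHc].
  by exists 0 => e _; exists 0; rewrite ?rmorph0 // dhomog0.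
rewrite polyCD; apply: addC.
  by move/(mulC i): IHc; rewrite dehomX Ei polyCM.
exists 0 => e _; exists (a%:MP * 'X_k ^+ e).
  by rewrite mul_mpolyC dhomogZ //; have := dhomogMn e (homX k); rewrite mul1n.
rewrite rmorphM rmorphXn /= dehomX Ek expr1n mulr1.
exact: (mmapC _
  (polyC \o polyC : {rmorphism K -> {poly {poly K}}})).
Qed.

End Chart.

(** * The affine Fermat curve and its coordinate ring over [K[x]] *)

Section AffineModel.

Variables (K F : fieldType) (iota : {rmorphism K -> F}) (n : nat).
Implicit Types (P Q : {poly {poly K}}) (p q : {poly K}) (x y f g : F).
Implicit Types a b : K.

(** With [Y] outermost the equation is monic of degree [n] over [K[X]] when [n > 0], so division
    with remainder is available. *)
Definition fermat_poly : {poly {poly K}} := 'X^n + ('X^n + 1)%:P.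

(** The coordinate ring of the affine curve embeds in [F], with [F] as its field of fractions. *)
Definition affine_model x y : Prop :=
  [/\ x ^+ n + y ^+ n + 1 = 0,
      forall P, eval2 iota x y P = 0 -> exists Q, P = Q * fermat_poly
    & forall f, exists P Q,
        eval2 iota x y Q != 0 /\ f = eval2 iota x y P / eval2 iota x y Q].

Definition regular_at x y a b f : Prop :=
  exists P Q, eval2 idfun a b Q != 0 /\
    f = eval2 iota x y P / eval2 iota x y Q.

Definition eval1 x : {poly K} -> F := horner_eval x \o map_poly iota.

HB.instance Definition _ x :=
  GRing.RMorphism.copy (eval1 x) (horner_eval x \o map_poly iota).

Lemma eval1X x : eval1 x 'X = x.
Proof. by rewrite /eval1 /= map_polyX /horner_eval hornerX. Qed.

Lemma eval1C x a : eval1 x a%:P = iota a.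
Proof. by rewrite /eval1 /= map_polyC /horner_eval hornerC. Qed.

Lemma eval1M x p q : eval1 x (p * q) = eval1 x p * eval1 x q.
Proof. exact: (rmorphM (eval1 x)). Qed.

Lemma eval1_XsubC x a : eval1 x ('X - a%:P) = x - iota a.
Proof. by rewrite (rmorphB (eval1 x)) /= eval1X eval1C. Qed.

Lemma eval1_exp x p m : eval1 x (p ^+ m) = eval1 x p ^+ m.
Proof. exact: (rmorphXn (eval1 x)). Qed.

Lemma eval1_wide x p m : (size p <= m)%N ->
  eval1 x p = \sum_(i < m) iota p`_i * x ^+ i.
Proof.
move=> pm; rewrite /eval1 /= /horner_eval (horner_coef_wide x (n := m)).
  by apply: eq_bigr => i _; rewrite coef_map.
exact: leq_trans (size_poly _ _) pm.
Qed.

Lemma eval2_eval1C x y p : eval2 iota x y p%:P = eval1 x p.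
Proof. exact: eval2C. Qed.

Lemma eval2_eval1 x y P : eval2 iota x y P = (map_poly (eval1 x) P).[y].
Proof.
rewrite eval2_sum (horner_coef_wide _ (size_poly _ _)).
by apply: eq_bigr => i _; rewrite coef_map.
Qed.

Lemma eval2_wide x y P m : (size P <= m)%N ->
  eval2 iota x y P = \sum_(j < m) eval1 x P`_j * y ^+ j.
Proof.
move=> Pm; rewrite eval2_eval1 (horner_coef_wide y (n := m)).
  by apply: eq_bigr => i _; rewrite coef_map.
exact: leq_trans (size_poly _ _) Pm.
Qed.

Lemma eval2_map_polyC (L : fieldType) (h : {rmorphism K -> L}) (u v : L) p :
  eval2 h u v (map_poly polyC p) = (map_poly h p).[v].
Proof.
rewrite eval2_sum size_map_polyC (horner_coef_wide _ (size_poly _ _)).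
by apply: eq_bigr => i _; rewrite !coef_map map_polyC hornerC.
Qed.

Lemma eval2_poly_comp x y (S : {poly {poly K}}) Q :
  eval2 iota x y (S \Po Q) = (map_poly (eval1 x) S).[eval2 iota x y Q].
Proof.
rewrite comp_polyE rmorph_sum /= (horner_coef_wide _ (size_poly _ _)).
apply: eq_bigr => i _.
by rewrite -mul_polyC eval2M eval2_exp eval2C coef_map.
Qed.

Lemma size_fermat_poly : (0 < n)%N -> size fermat_poly = n.+1.
Proof.
move=> n_gt0; rewrite size_polyDl ?size_polyXn // ltnS.
exact: leq_trans (size_polyC_leq1 _) n_gt0.
Qed.

Lemma fermat_poly_monic : (0 < n)%N -> fermat_poly \is monic.
Proof.
move=> n_gt0; rewrite monicE lead_coefDl ?lead_coefXn //.
by rewrite size_polyXn ltnS; apply: leq_trans (size_polyC_leq1 _) n_gt0.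
Qed.

Lemma eval2_fermat_poly (L : fieldType) (h : {rmorphism K -> L}) (x y : L) :
  eval2 h x y fermat_poly = x ^+ n + y ^+ n + 1.
Proof.
rewrite /fermat_poly eval2D polyCD polyC_exp eval2D !eval2_exp eval2X.
by rewrite eval2_innerX eval2_1 addrCA addrA.
Qed.

Lemma eval2_id a b P : eval2 idfun a b P = (map_poly (horner_eval a) P).[b].
Proof.
rewrite eval2_sum (horner_coef_wide _ (size_poly _ _)).
by apply: eq_bigr => i _; rewrite coef_map map_poly_id.
Qed.

(** Every coefficient in [K[X]] has the root [a], so [X - a] divides each. The size bound keeps the
    degree in [Y] below [n] during cancellation. *)
Lemma factor_fiber_vanishing a P :
  map_poly (horner_eval a) P = 0 ->
  exists2 P1 : {poly {poly K}}, (size P1 <= size P)%N & P = ('X - a%:P)%:P * P1.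
Proof.
move=> Pa0; exists (\poly_(i < size P) (P`_i %/ ('X - a%:P))).
  exact: size_poly.
apply/polyP=> i; rewrite coefCM coef_poly; case: ltnP => [_|/leq_sizeP->//].
  rewrite mulrC divpK // dvdp_XsubCl /root.
  by have /polyP/(_ i) := Pa0; rewrite coef_map coef0 => /eqP.
by rewrite mulr0.
Qed.

Section Model.

Variables (x y : F).
Hypothesis (n_gt0 : (0 < n)%N) (xy_model : affine_model x y).

(** The difference is a multiple of [fermat_poly], which vanishes at [(a, b)]. This specializes
    identities in [F] to points of the curve. *)
Lemma model_eq_at P Q a b : eval2 iota x y P = eval2 iota x y Q ->
  a ^+ n + b ^+ n + 1 = 0 -> eval2 idfun a b P = eval2 idfun a b Q.
Proof.
move=> PQ ab; have [_ ker _] := xy_model.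
have /ker[R PQR]: eval2 iota x y (P - Q) = 0.
  by rewrite eval2B PQ subrr.
rewrite -[P](subrK Q) PQR eval2D eval2M eval2_fermat_poly ab mulr0.
by rewrite add0r.
Qed.

(** A nonzero multiple of a monic polynomial of degree [n] in [Y] has degree at least [n]. *)
Lemma model_inj P : (size P <= n)%N -> eval2 iota x y P = 0 -> P = 0.
Proof.
have [_ ker _] := xy_model => sP /ker[Q PQ]; move: sP; rewrite PQ.
have [-> | Q0] := eqVneq Q 0; first by rewrite mul0r.
rewrite size_Mmonic ?fermat_poly_monic // size_fermat_poly // addnS /=.
by rewrite -[leqRHS]add0n leq_add2r leqn0 size_poly_eq0 (negPf Q0).
Qed.

Lemma eval1_eq0 q : (eval1 x q == 0) = (q == 0).
Proof.
apply/eqP/eqP => [q0|->]; last by rewrite rmorph0.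
apply/eqP; rewrite -polyC_eq0; apply/eqP/model_inj.
  exact: leq_trans (size_polyC_leq1 _) n_gt0.
by rewrite eval2C.
Qed.

Lemma model_reduce P :
  exists2 Q : {poly {poly K}}, (size Q <= n)%N &
    eval2 iota x y P = eval2 iota x y Q.
Proof.
have [xyn _ _] := xy_model.
exists (Pdiv.Ring.rmodp P fermat_poly).
  rewrite -ltnS -size_fermat_poly // Pdiv.Ring.ltn_rmodpN0 // monic_neq0 //.
  exact: fermat_poly_monic.
rewrite {1}(Pdiv.RingMonic.rdivp_eq (fermat_poly_monic n_gt0) P) eval2D eval2M.
by rewrite eval2_fermat_poly xyn mulr0 add0r.
Qed.

Lemma model_integral P : integralOver (eval1 x) (eval2 iota x y P).
Proof.
rewrite eval2_eval1; apply: integral_horner.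
  by apply/integral_poly => i; rewrite coef_map; apply: integral_id.
have [xyn _ _] := xy_model.
exists fermat_poly; first exact: fermat_poly_monic.
by rewrite rootE -eval2_eval1 eval2_fermat_poly xyn.
Qed.

(** A denominator [Q] is integral over [K[x]]; an integral equation with nonzero constant term
    exhibits that constant as a multiple of [Q]. *)
Lemma model_denominator g :
  exists2 q, q != 0 &
    exists2 P : {poly {poly K}}, (size P <= n)%N &
      g * eval1 x q = eval2 iota x y P.
Proof.
have [_ _ /(_ g)[P [Q [Q0 ->]]]] := xy_model.
suff [q q0 [R qR]] : exists2 q, q != 0 &
    exists R, eval1 x q = eval2 iota x y Q * eval2 iota x y R.
  exists q => //; have [S sS eS] := model_reduce (P * R).
  by exists S => //; rewrite qR mulrA divfK // -eS eval2M.
have [S /monic_neq0 S0 /rootP] := model_integral Q.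
(* A zero constant term is removed by dividing the equation by [Q], which is nonzero. *)
elim/poly_ind: S S0 => [|S c IH]; first by rewrite eqxx.
have [-> | c0 _] := eqVneq c 0; last first.
  rewrite rmorphD rmorphM /= map_polyX map_polyC /= hornerMXaddC.
  move=> /eqP; rewrite addrC addr_eq0 => /eqP cE; exists c => //.
  by exists (- (S \Po Q)); rewrite cE eval2N eval2_poly_comp mulrN mulrC.
rewrite addr0 mulf_eq0 polyX_eq0 orbF => /IH {}IH.
rewrite rmorphM /= map_polyX hornerMX => /eqP.
by rewrite mulf_eq0 (negPf Q0) orbF => /eqP/IH.
Qed.

End Model.

End AffineModel.

Lemma sqrrD_pchar2 (R : comNzRingType) (u v : R) :
  2%N \in [pchar R] -> (u + v) ^+ 2 = u ^+ 2 + v ^+ 2.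
Proof.
by move=> char2; rewrite sqrrD mulr2n addrr_pchar2 // addr0.
Qed.

(** The derivative [n X^(n-1)] vanishes only at 0, which is not a root, so the polynomial is
    separable. *)
Lemma root_list_Xn_addC (K : closedFieldType) (n : nat) (c : K) :
  (0 < n)%N -> n%:R != 0 :> K -> c != 0 ->
  exists r : seq K, [/\ uniq r, size r = n & {in r, forall z, z ^+ n + c = 0}].
Proof.
move=> n_gt0 nK c0; have [r] := closed_field_poly_normal ('X^n + c%:P).
rewrite lead_coefXnaddC // scale1r => Xn_r; exists r.
have size_r : size r = n.
  by apply: succn_inj; rewrite -(size_prod_XsubC r id) -Xn_r size_XnaddC.
split=> // [|z].
  rewrite -separable_prod_XsubC -Xn_r unlock derivD derivXn derivC.
  rewrite addr0 -scaler_nat coprimepZr //; apply: coprimep_expr.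
  by rewrite coprimepX /root !hornerE expr0n eqn0Ngt n_gt0 add0r.
by rewrite -root_prod_XsubC -Xn_r /root !hornerE => /eqP.
Qed.

(** * Cancelling denominators fibre by fibre over the [x]-line *)

Section Fiber.

Variables (K : closedFieldType) (F : fieldType) (iota : {rmorphism K -> F}).
Variables (n : nat) (x y : F).
Hypotheses (char_K : 2%N \in [pchar K]) (n_odd : odd n).
Hypothesis xy_model : affine_model iota n x y.

Let n_gt0 : (0 < n)%N := odd_gt0 n_odd.

Let nK : n%:R != 0 :> K.
Proof. by rewrite -(dvdn_pcharf char_K) dvdn2 n_odd. Qed.

(** With [y = 0], [x] would be a root of [X^n + 1], although it is transcendental over [K]. *)
Lemma model_y_neq0 : y != 0.
Proof.
apply/eqP => y0; have [] := xy_model.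
rewrite y0 expr0n eqn0Ngt n_gt0 addr0 => /eqP xn _ _.
have: eval1 iota x ('X^n + 1%:P) == 0.
  by rewrite rmorphD rmorphXn /= eval1X eval1C rmorph1.
rewrite (eval1_eq0 n_gt0 xy_model) => /eqP/(congr1 (size \o val)) /=.
by rewrite size_XnaddC // size_poly0.
Qed.

Lemma fiber_vanishes (a : K) (P : {poly {poly K}}) (q : {poly K}) (g : F) :
  (size P <= n)%N -> g * eval1 iota x (q * ('X - a%:P)) = eval2 iota x y P ->
  (forall b, a ^+ n + b ^+ n + 1 = 0 -> regular_at iota x y a b (g ^+ 2)) ->
  map_poly (horner_eval a) P = 0.
Proof.
have charF : 2%N \in [pchar F] := rmorph_pchar iota char_K.
move=> sP gP regP; apply/eqP/negPn/negP => pa0.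
set pa := map_poly _ P in pa0.
have spa : (size pa <= n)%N by apply: leq_trans (size_poly _ _) sP.
(* If [a ^+ n + 1] is nonzero, the fibre has [n] distinct points, all roots of [pa]: more than its
   degree allows. *)
have [an0 | an0] := eqVneq (a ^+ n + 1) 0; last first.
  have [r [uniq_r size_r root_r]] := root_list_Xn_addC n_gt0 nK an0.
  suff /max_poly_roots : all (root pa) r.
    by move=> /(_ pa0 uniq_r); rewrite size_r ltnNge spa.
  apply/allP => b /root_r ab.
  have {}ab : a ^+ n + b ^+ n + 1 = 0 by rewrite addrAC addrC.
  have [A [B [B0 gAB]]] := regP b ab.
  rewrite /root -eval2_id.
  have B1 : eval2 iota x y B != 0.
    apply: contraNneq B0 => B0.
    rewrite (model_eq_at xy_model (Q := 0) _ ab) ?eval2_0 //.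
  have : eval2 iota x y (P ^+ 2 * B) =
      eval2 iota x y (A * ((q * ('X - a%:P))%:P) ^+ 2).
    rewrite !(eval2_exp, eval2M) -gP exprMn gAB eval2_eval1C mulrAC divfK //.
  move=> /(model_eq_at xy_model)/(_ ab)/eqP.
  rewrite !(eval2_exp, eval2M) eval2C map_poly_id // hornerM hornerXsubC subrr.
  by rewrite mulr0 expr0n mulr0 mulf_eq0 (negPf B0) orbF sqrf_eq0.
have a0 : a != 0.
  apply/eqP => a0; move/eqP: an0; rewrite a0 expr0n eqn0Ngt n_gt0 add0r.
  by rewrite oner_eq0.
have ab : a ^+ n + 0 ^+ n + 1 = 0 by rewrite expr0n eqn0Ngt n_gt0 addr0.
have [A [B [B0 gAB]]] := regP 0 ab.
have B1 : eval2 iota x y B != 0.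
  apply: contraNneq B0 => B0.
  by rewrite (model_eq_at xy_model (Q := 0) _ ab) ?eval2_0.
(* Now [(a, 0)] is the only point over [a]. The order [k] of [pa] at 0 is below [n], which is to be
   refuted. *)
have [k [u]] := multiplicity_XsubC pa 0.
rewrite pa0 subr0 /= => u0 pa_u.
have u_neq0 : u != 0 by apply: contraNneq pa0 => u_0; rewrite pa_u u_0 mul0r.
have kn : (k < n)%N.
  apply: leq_trans spa; rewrite pa_u size_Mmonic ?monicXn // size_polyXn addnS.
  by rewrite /= -[k.+1]add1n leq_add2r size_poly_gt0.
pose U : {poly {poly K}} := map_poly (polyC : K -> {poly K}) u.
have [R _ PR] : exists2 R : {poly {poly K}},
    (size R <= size (P - U * 'X^k)%R)%N &
    P - U * 'X^k = ('X - a%:P)%:P * R.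
  apply: factor_fiber_vanishing; rewrite rmorphB rmorphM /= -/pa map_polyXn.
  rewrite -map_poly_comp map_poly_id ?pa_u ?subrr // => c _ /=.
  by rewrite /horner_eval hornerC.
(* [E] is the cofactor of [X - a] in [X^n - a^n]. As [E.[a]] is nonzero, [y^n] is a unit multiple of
   [x - a] near [(a, 0)]. *)
pose E : {poly K} := \sum_(i < n) 'X^(n.-1 - i) * (a%:P) ^+ i.
have EX : 'X^n - (a ^+ n)%:P = ('X - a%:P) * E by rewrite polyC_exp subrXX.
have Ea : E.[a] != 0.
  suff -> : E.[a] = a ^+ n.-1 *+ n.
    by rewrite -mulr_natl mulf_neq0 ?expf_neq0.
  rewrite horner_sum (eq_bigr (fun=> a ^+ n.-1)) => [|i _].
    by rewrite sumr_const card_ord.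
  rewrite !hornerE -exprD subnK //.
  by rewrite -ltnS prednK.
have yE : y ^+ n = - ((x - iota a) * eval1 iota x E).
  have := congr1 (eval1 iota x) EX.
  rewrite rmorphM !rmorphB rmorphXn /= !eval1C eval1X => <-.
  have -> : iota (a ^+ n) = -1.
    by apply/eqP; rewrite -addr_eq0 -(rmorph1 iota) -rmorphD an0 rmorph0.
  have [xyn _ _] := xy_model; apply/eqP; rewrite opprK -addr_eq0.
  by rewrite addrA [y ^+ n + _]addrC xyn.
(* Substitute [P = U Y^k + (X - a) R] into [g q (x - a) = P], multiply by [E] and cancel [y^k]. *)
have key : eval2 iota x y U * eval1 iota x E =
    y ^+ (n - k) * (eval2 iota x y R - g * eval1 iota x q).
  apply: (mulIf (expf_neq0 k model_y_neq0)).
  have -> : eval2 iota x y U * eval1 iota x E * y ^+ k =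
      eval2 iota x y (U * 'X^k) * eval1 iota x E.
    by rewrite eval2M eval2_exp eval2X mulrAC.
  rewrite -[U * _](subKr P) PR eval2B -gP eval2M eval2_eval1C.
  rewrite mulrAC -exprD subnK ?(ltnW kn) // yE.
  rewrite eval1M !eval1_XsubC.
  by ring.
(* Squaring allows [g^2 = A / B] to be used; at [(a, 0)] the right side vanishes because [k < n],
   the left side does not. *)
have : eval2 iota x y ((U * E%:P) ^+ 2 * B) =
    eval2 iota x y (('X^(n - k)) ^+ 2 * (R ^+ 2 * B + A * (q%:P) ^+ 2)).
  rewrite !(eval2_exp, eval2M, eval2D) !eval2_eval1C key eval2X.
  rewrite exprMn -mulrA; congr (_ * _).
  rewrite oppr_pchar2 // sqrrD_pchar2 // exprMn gAB mulrDl.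
  by rewrite [X in _ + X]mulrAC divfK.
move=> /(model_eq_at xy_model)/(_ ab)/eqP.
rewrite !(eval2_exp, eval2M, eval2D) eval2X !eval2C eval2_map_polyC.
rewrite !map_poly_id // expr0n subn_eq0 leqNgt kn expr0n mul0r.
rewrite mulf_eq0 (negPf B0) orbF sqrf_eq0 mulf_eq0 (negPf Ea) orbF.
exact: negP.
Qed.

(** Induction on the size of the denominator [q]: a nonconstant [q] has a root [a], and
    [fiber_vanishes] lets [X - a] be cancelled. *)
Lemma regular_square_polynomial (g : F) :
  (forall a b, a ^+ n + b ^+ n + 1 = 0 ->
     regular_at iota x y a b (g ^+ 2)) ->
  exists2 P : {poly {poly K}}, (size P <= n)%N & g = eval2 iota x y P.
Proof.
move=> reg_g; have [q q0 [P sP gP]] := model_denominator n_gt0 xy_model g.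
have [m] := ubnP (size q); elim: m q q0 P sP gP => // m IH q q0 P sP gP sq.
have [sq1 | sq1] := eqVneq (size q) 1%N.
  have /size_poly1P[c c0 qc] : size q == 1%N by apply/eqP.
  exists (P * c^-1%:P%:P).
    by rewrite mulrC mul_polyC; apply: leq_trans (size_scale_leq _ _) sP.
  rewrite eval2M -gP qc eval1C eval2_const -mulrA -rmorphM divff //.
  by rewrite rmorph1 mulr1.
have /closed_rootP[a /factor_theorem[q1 qE]] := sq1.
have Pa : map_poly (horner_eval a) P = 0.
  by apply: (@fiber_vanishes a P q1 g); rewrite -?qE // => b; apply: reg_g.
have [P1 sP1 PE] := factor_fiber_vanishing Pa.
have q10 : q1 != 0 by apply: contraNneq q0 => q10; rewrite qE q10 mul0r.
apply: (IH q1 q10 P1); first exact: leq_trans sP1 sP.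
  have Xa0 : eval1 iota x ('X - a%:P) != 0.
    by rewrite (eval1_eq0 n_gt0 xy_model) polyXsubC_eq0.
  apply: (mulIf Xa0); rewrite -mulrA -eval1M -qE gP PE eval2M eval2_eval1C.
  exact: mulrC.
by move: sq; rewrite qE size_Mmonic ?monicXsubC // size_XsubC addn2 ltnS.
Qed.

End Fiber.

(** * Charts of the function field *)

Section FunctionField.

Variables (K F : fieldType) (iota : {rmorphism K -> F}).
Variables (M : nat) (xi : 'I_3 -> F).
Hypothesis char_K : 2%N \in [pchar K].

Notation n := (M.*2.+1).

Hypothesis F_fun : is_function_field iota (fermat_form K n) xi.

Let char_F : 2%N \in [pchar F] := rmorph_pchar iota char_K.

Lemma mmap_mpolyX l : mmap iota xi 'X_l = xi l.
Proof. by rewrite mmapX mmap1U. Qed.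

Lemma mmapM_rmorph (A B : {mpoly K[3]}) :
  mmap iota xi (A * B) = mmap iota xi A * mmap iota xi B.
Proof. exact: (rmorphM (mmap iota xi)). Qed.

Lemma mmap_exp (A : {mpoly K[3]}) m :
  mmap iota xi (A ^+ m) = mmap iota xi A ^+ m.
Proof. exact: (rmorphXn (mmap iota xi)). Qed.

Lemma homog_mpolyX (l : 'I_3) : ('X_l : {mpoly K[3]}) \is 1.-homog.
Proof. by rewrite dhomogX /= mdeg1. Qed.

Lemma fermat_form_homog : fermat_form K n \is n.-homog.
Proof.
apply: rpred_sum => l _.
by have := dhomogMn n (homog_mpolyX l); rewrite mul1n.
Qed.

Lemma fermat_form_generic : mmap iota xi (fermat_form K n) = 0.
Proof.
have [ker _] := F_fun; apply/(ker n _ fermat_form_homog).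
by exists 1; rewrite mul1r.
Qed.

Definition partial (l : 'I_3) (A : {mpoly K[3]}) : F := mmap iota xi A^`M(l).

Lemma partialM l A B :
  partial l (A * B) =
    partial l A * mmap iota xi B + mmap iota xi A * partial l B.
Proof. by rewrite /partial mderivM mmapD !mmapM_rmorph. Qed.

Lemma partialB l A B : partial l (A - B) = partial l A - partial l B.
Proof. by rewrite /partial mderivB mmapB. Qed.

Lemma partial_sqr l A : partial l (A ^+ 2) = 0.
Proof. by rewrite expr2 partialM mulrC addrr_pchar2. Qed.

Lemma partial_mpolyX l m : partial l 'X_m = (m == l)%:R.
Proof.
rewrite /partial mderivX mnm1E; case: eqP => [->|_]; last first.
  by rewrite scale0r mmap0.
have -> : (U_(l) - U_(l) = 0)%MM by rewrite -{1}[U_(l)%MM]add0m addmK.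
by rewrite scale1r mpolyX0 rmorph1.
Qed.

(** In [X^n = (X^M)^2 X] the square has zero derivative in characteristic 2. *)
Lemma partial_fermat_form l : partial l (fermat_form K n) = xi l ^+ M ^+ 2.
Proof.
have pXn m : partial l ('X_m ^+ n) = (m == l)%:R * xi m ^+ M ^+ 2.
  rewrite exprSr -muln2 exprM partialM partial_sqr mul0r add0r partial_mpolyX.
  by rewrite mulrC !mmap_exp mmap_mpolyX.
have partialD A B : partial l (A + B) = partial l A + partial l B.
  by rewrite /partial mderivD mmapD.
have partial0 : partial l 0 = 0 by rewrite /partial mderiv0 mmap0.
rewrite /fermat_form (big_morph _ partialD partial0) (bigD1 l) //=.
rewrite pXn eqxx mul1r big1 ?addr0 //.
by move=> m /negPf ml; rewrite pXn ml mul0r.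
Qed.

Lemma big_ord3 (i j k : 'I_3) (R : nmodType) (f : 'I_3 -> R) :
  uniq [:: i; j; k] -> \sum_(l < 3) f l = f i + f j + f k.
Proof.
move=> ijk.
have -> : \sum_(l < 3) f l = \sum_(l in [:: i; j; k]) f l.
  by apply: eq_bigl => l; rewrite !inE; case: (ord3_cases ijk l) => ->;
    rewrite eqxx ?orbT.
by rewrite -big_uniq // !big_cons big_nil /= addr0 addrA.
Qed.

Lemma meval_fermat_form (i j k : 'I_3) m (v : 'I_3 -> K) :
  uniq [:: i; j; k] ->
  (fermat_form K m).@[v] = v i ^+ m + v j ^+ m + v k ^+ m.
Proof.
move=> ijk; rewrite /fermat_form (big_ord3 _ ijk) !mevalD.
by rewrite !(rmorphXn (meval v)) /= !mevalXU.
Qed.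

(** Otherwise the Fermat form divides ['X_k]; but at a point with coordinates 0, 1, 1 and [k]-th
    coordinate 1 the form is [1 + 1 = 0]. *)
Lemma generic_coord_neq0 (k : 'I_3) : xi k != 0.
Proof.
have [i [j ijk]] : exists i j, uniq [:: i; j; k].
  by case: k => [[|[|[|?]]] ?] //; [exists 1, 2 | exists 0, 2 | exists 0, 1].
apply/eqP => xik0; have [/(_ 1%N _ (homog_mpolyX k))[+ _] _] := F_fun.
rewrite mmap_mpolyX => /(_ xik0)[Q /(congr1 (meval (affine_coord i j 0 1)))].
have [Ei Ej Ek] := affine_coordE ijk (0 : K) 1.
rewrite mevalM mevalXU (meval_fermat_form _ _ ijk).
rewrite Ei Ej Ek expr1n expr0n /= add0r addrr_pchar2 // mulr0 => /eqP.
by rewrite oner_eq0.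
Qed.

Section GenericChart.

Variables (i j k : 'I_3).
Hypothesis ijk : uniq [:: i; j; k].

Lemma dehom_fermat_form : dehom i j (fermat_form K n) = fermat_poly K n.
Proof.
have [Ei Ej Ek] := affine_coordE ijk ('X%:P : {poly {poly K}}) 'X.
rewrite /fermat_form (big_ord3 _ ijk) !rmorphD !rmorphXn /= !dehomX.
rewrite Ei Ej Ek expr1n.
by rewrite /fermat_poly polyCD polyC_exp addrA [_ + 'X^n]addrC.
Qed.

Lemma generic_affine_model :
  affine_model iota n (xi i / xi k) (xi j / xi k).
Proof.
have xik := generic_coord_neq0 k.
split=> [|P P0|f].
- have := eval2_dehom ijk iota xik fermat_form_homog.
  rewrite fermat_form_generic dehom_fermat_form eval2_fermat_poly => /esym/eqP.
  by rewrite mulf_eq0 (negPf (expf_neq0 _ xik)) => /eqP.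
- have [e [A homA AP]] := dehom_surj ijk P.
  have [/(_ e A homA)[+ _] _] := F_fun.
  rewrite (eval2_dehom ijk iota xik homA) AP P0 mulr0 => /(_ erefl)[Q AQ].
  by exists (dehom i j Q); rewrite -AP AQ rmorphM /= dehom_fermat_form.
have [_ /(_ f)[e [A [B [homA homB + ->]]]]] := F_fun.
rewrite !(eval2_dehom ijk iota xik homA, eval2_dehom ijk iota xik homB).
rewrite mulf_eq0 negb_or => /andP[xie B0].
by exists (dehom i j A), (dehom i j B); rewrite -mulf_div divff // mul1r.
Qed.

Lemma regular_function_chart (a b : K) f :
  regular_function_at iota xi (affine_coord i j a b) f ->
  regular_at iota (xi i / xi k) (xi j / xi k) a b f.
Proof.
have [Ei Ej Ek] := affine_coordE ijk a b.
have xik := generic_coord_neq0 k.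
have v0 : affine_coord i j a b k != 0 by rewrite Ek oner_neq0.
case=> e [A [B [homA homB + ->]]].
rewrite /meval (eval2_dehom ijk idfun v0 homB) Ei Ej Ek !divr1 expr1n mul1r.
move=> B0; exists (dehom i j A), (dehom i j B); split=> //.
rewrite (eval2_dehom ijk iota xik homA) (eval2_dehom ijk iota xik homB).
by rewrite -mulf_div divff ?mul1r // expf_neq0.
Qed.

Lemma affine_curve_point (a b : K) : a ^+ n + b ^+ n + 1 = 0 ->
  curve_point (fermat_form K n) (affine_coord i j a b).
Proof.
have [Ei Ej Ek] := affine_coordE ijk a b => ab.
have v0 : affine_coord i j a b k != 0 by rewrite Ek oner_neq0.
split; first by exists k.
rewrite /meval (eval2_dehom ijk idfun v0 fermat_form_homog) Ei Ej Ek !divr1.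
by rewrite dehom_fermat_form eval2_fermat_poly ab mulr0.
Qed.

(* If [x = (A / B)^2], then [X_i B^2 - X_k A^2 = Q G] for the Fermat form [G];
   applying the partials along [j] and along [i] makes first [Q] and then [B]
   vanish at the generic point. *)
Lemma generic_coord_not_square : separating 2 (xi i / xi k).
Proof.
case=> u; have [_ /(_ u)[e [A [B [homA homB B0 ->]]]]] := F_fun.
have xik := generic_coord_neq0 k; rewrite expr_div_n => xAB.
have [ij ik jk] : [/\ i != j, i != k & k != j].
  by move: ijk; rewrite /= !inE negb_or andbT (eq_sym k) => /andP[/andP[]].
pose C := 'X_i * B ^+ 2 - 'X_k * A ^+ 2.
have homC : C \is (1 + e * 2).-homog.
  by apply: rpredB; apply: dhomogM (homog_mpolyX _) (dhomogMn _ _).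
have [/(_ _ _ homC)[+ _] _] := F_fun.
case=> [|Q CQ].
  rewrite /C mmapB !(mmap_exp, mmapM_rmorph) !mmap_mpolyX.
  by apply/eqP; rewrite subr_eq0 [xi k * _]mulrC -eqr_div ?expf_neq0 // xAB.
have partialC l : partial l C =
    (i == l)%:R * mmap iota xi B ^+ 2 - (k == l)%:R * mmap iota xi A ^+ 2.
  rewrite partialB !(partial_sqr, partialM) !mulr0 !addr0 !partial_mpolyX.
  by rewrite !mmap_exp.
have partialQ l : partial l C = mmap iota xi Q * xi l ^+ M ^+ 2.
  by rewrite CQ partialM fermat_form_generic mulr0 add0r partial_fermat_form.
have Q0 : mmap iota xi Q = 0.
  have := partialC j; rewrite partialQ (negPf ij) (negPf jk) !mul0r subrr.
  have xij := generic_coord_neq0 j.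
  by move=> /eqP; rewrite mulf_eq0 !expf_eq0 (negPf xij) !andbF orbF => /eqP.
have := partialC i; rewrite partialQ Q0 mul0r eqxx eq_sym (negPf ik) mul0r.
by rewrite subr0; move/esym/eqP; rewrite mul1r sqrf_eq0 (negPf B0).
Qed.

End GenericChart.

End FunctionField.

(** * Differentials *)

Section Derivation.

Variables (K F : fieldType) (iota : {rmorphism K -> F}).
Hypothesis char_K : 2%N \in [pchar K].
Variables (Om : lmodType F) (d : F -> Om).
Hypothesis der_d : is_derivation iota d.

Let char_F : 2%N \in [pchar F] := rmorph_pchar iota char_K.

Lemma derivation0 : d 0 = 0.
Proof. by have [_ _ dC] := der_d; rewrite -(rmorph0 iota) dC. Qed.

Lemma derivation_sqr f : d (f ^+ 2) = 0.
Proof.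
by have [_ dM _] := der_d; rewrite expr2 dM -scalerDl addrr_pchar2 // scale0r.
Qed.

Lemma derivation_sqrM f g : d (f ^+ 2 * g) = f ^+ 2 *: d g.
Proof. by have [_ dM _] := der_d; rewrite dM derivation_sqr scaler0 addr0. Qed.

(** [f^-1 = (f^-1)^2 f], and squares pass through [d]. The default [0^-1 = 0] makes the case [f = 0]
    hold too. *)
Lemma derivation_inv f : d f^-1 = f ^- 2 *: d f.
Proof.
have [->|f0] := eqVneq f 0; first by rewrite invr0 derivation0 scaler0.
by rewrite -exprVn -derivation_sqrM expr2 mulfVK.
Qed.

End Derivation.

(** * Square decomposition of [F] and the form [dx / y^(2M)] *)

Section Differential.

Variables (K : closedFieldType) (F : fieldType) (iota : {rmorphism K -> F}).
Variables (M : nat) (x y : F).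
Hypothesis char_K : 2%N \in [pchar K].

Notation n := (M.*2.+1).

Hypothesis xy_model : affine_model iota n x y.

Let char_F : 2%N \in [pchar F] := rmorph_pchar iota char_K.

Let n_odd : odd n. Proof. by rewrite /= odd_double. Qed.

Let y_neq0 : y != 0 := model_y_neq0 n_odd xy_model.

Lemma expr_odd (R : comNzRingType) (u : R) : u ^+ n = (u ^+ M) ^+ 2 * u.
Proof. by rewrite exprSr -muln2 exprM. Qed.

Lemma sqrt_exists (c : K) : exists e, c = e ^+ 2.
Proof.
have [e] := @solve_monicpoly K 2 (fun i => if i == 0%N then c else 0) isT.
by rewrite big_ord_recl big_ord1 /= mul0r addr0 mulr1 => <-; exists e.
Qed.

(** Membership in the field [F^2(x)], which turns out to be all of [F]. *)
Definition sqr_combination f := exists u v : F, f = u ^+ 2 + v ^+ 2 * x.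

Lemma sqr_combinationD f g :
  sqr_combination f -> sqr_combination g -> sqr_combination (f + g).
Proof.
move=> [u1 [v1 ->]] [u2 [v2 ->]]; exists (u1 + u2), (v1 + v2).
by rewrite !sqrrD_pchar2 // mulrDl addrACA.
Qed.

Lemma sqr_combinationM f g :
  sqr_combination f -> sqr_combination g -> sqr_combination (f * g).
Proof.
move=> [u1 [v1 ->]] [u2 [v2 ->]].
exists (u1 * u2 + v1 * v2 * x), (u1 * v2 + u2 * v1).
by rewrite !sqrrD_pchar2 //; ring.
Qed.

Lemma sqr_combinationV f : sqr_combination f -> sqr_combination f^-1.
Proof.
move=> [u [v fE]]; have [-> | f0] := eqVneq f 0.
  by exists 0, 0; rewrite invr0 expr0n mul0r addr0.
(* [f^-1 = f / f^2]. *)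
exists (u / f), (v / f); rewrite !expr_div_n [_ / _ * x]mulrAC -mulrDl -fE.
by rewrite expr2 invfM mulrA divff // mul1r.
Qed.

Lemma sqr_combination_eval2 P : sqr_combination (eval2 iota x y P).
Proof.
have sqrC c : sqr_combination (iota c).
  have [e ->] := sqrt_exists c.
  by exists (iota e), 0; rewrite rmorphXn expr0n mul0r addr0.
have sqrX : sqr_combination x by exists 0, 1; rewrite expr0n expr1n mul1r add0r.
have sqrY : sqr_combination y.
  (* [y = y^n / (y^M)^2] with [y^n = 1 + (x^M)^2 x]. *)
  exists (y ^- M), (x ^+ M / y ^+ M).
  have yM : y ^+ M != 0 by rewrite expf_neq0.
  have [+ _ _] := xy_model.
  rewrite !expr_odd => xy1.
  have yE : (y ^+ M) ^+ 2 * y = 1 + (x ^+ M) ^+ 2 * x.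
    apply/eqP; rewrite -subr_eq0 oppr_pchar2 // -xy1; apply/eqP; ring.
  by rewrite -[y in LHS](mulKf (expf_neq0 2 yM)) yE; field.
elim/poly_ind: P => [|P c IH]; first by rewrite eval2_0 -(rmorph0 iota).
rewrite eval2D eval2M eval2X; apply: sqr_combinationD.
  exact: sqr_combinationM.
elim/poly_ind: c => [|c e IHc]; first by rewrite eval2_0 -(rmorph0 iota).
rewrite polyCD polyCM eval2D eval2M eval2_innerX eval2_const.
by apply: sqr_combinationD => //; apply: sqr_combinationM.
Qed.

Lemma sqr_combination_all f : sqr_combination f.
Proof.
have [_ _ /(_ f)[P [Q [_ ->]]]] := xy_model.
by apply: sqr_combinationM; [|apply: sqr_combinationV];
  apply: sqr_combination_eval2.
Qed.

(** As [x] is not a square, [v] in [f = u^2 + v^2 x] is unique, and [D f = v^2] is [df/dx]. *)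
Lemma derivation_exists : separating 2 x ->
  exists2 D : F -> F^o, is_derivation iota D & D x = 1.
Proof.
move=> sep_x.
have two0 : 2%:R = 0 :> F by rewrite pcharf0.
have uniq_v u v u' v' :
    u ^+ 2 + v ^+ 2 * x = u' ^+ 2 + v' ^+ 2 * x -> v = v'.
  move=> E; apply/eqP; rewrite -subr_eq0; apply/negPn/negP => vv'.
  apply: sep_x; exists ((u + u') / (v - v')); rewrite expr_div_n.
  apply: (canRL (mulfK _)); first by rewrite expf_neq0.
  rewrite oppr_pchar2 // !sqrrD_pchar2 // mulrC mulrDl.
  apply/eqP; rewrite -subr_eq0; apply/eqP.
  transitivity (u ^+ 2 + v ^+ 2 * x - (u' ^+ 2 + v' ^+ 2 * x) +
    2%:R * (v' ^+ 2 * x - u ^+ 2)); first by ring.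
  by rewrite E subrr two0 mul0r addr0.
have dec f : exists uv : F * F, f == uv.1 ^+ 2 + uv.2 ^+ 2 * x.
  by have [u [v ->]] := sqr_combination_all f; exists (u, v).
pose D f : F^o := (xchoose (dec f)).2 ^+ 2.
have DE u v : D (u ^+ 2 + v ^+ 2 * x) = v ^+ 2.
  rewrite /D; set uv := xchoose _.
  have /eqP/uniq_v -> // := xchooseP (dec (u ^+ 2 + v ^+ 2 * x)).
exists D; last by have := DE 0 1; rewrite expr0n expr1n mul1r add0r.
split=> [f g|f g|c].
- have [u1 [v1 ->]] := sqr_combination_all f.
  have [u2 [v2 ->]] := sqr_combination_all g.
  have -> : u1 ^+ 2 + v1 ^+ 2 * x + (u2 ^+ 2 + v2 ^+ 2 * x) =
      (u1 + u2) ^+ 2 + (v1 + v2) ^+ 2 * x.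
    by rewrite !sqrrD_pchar2 // mulrDl addrACA.
  by rewrite !DE; apply: sqrrD_pchar2.
- have [u1 [v1 ->]] := sqr_combination_all f.
  have [u2 [v2 ->]] := sqr_combination_all g.
  have -> : (u1 ^+ 2 + v1 ^+ 2 * x) * (u2 ^+ 2 + v2 ^+ 2 * x) =
      (u1 * u2 + v1 * v2 * x) ^+ 2 + (u1 * v2 + u2 * v1) ^+ 2 * x.
    by rewrite !sqrrD_pchar2 //; ring.
  rewrite !DE /GRing.scale /= sqrrD_pchar2 // !exprMn.
  transitivity ((u1 ^+ 2 + v1 ^+ 2 * x) * v2 ^+ 2 +
    (u2 ^+ 2 + v2 ^+ 2 * x) * v1 ^+ 2 - 2%:R * (v1 ^+ 2 * v2 ^+ 2 * x)).
    by ring.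
  by rewrite two0 mul0r subr0.
(* Constants are squares, so their [v] is 0. *)
have [e ->] := sqrt_exists c.
by have := DE (iota e) 0; rewrite expr0n mul0r addr0 rmorphXn.
Qed.

Section Kaehler.

Variables (Om : lmodType F) (d : F -> Om).
Hypothesis der_d : is_derivation iota d.

(** For [m = M] this is [ds / t^(n-1)], the residue form [ds / G_t] of the Fermat equation, since
    [n = 1] in [K]. Free arguments let it serve in every chart. *)
Definition fermat_differential (m : nat) (s t : F) : Om := (t ^+ m) ^- 2 *: d s.

Lemma fermat_differential_dx : d x = (y ^+ M) ^+ 2 *: fermat_differential M x y.
Proof. by rewrite scalerA divff ?scale1r // !expf_neq0. Qed.

(** Differentiating the equation gives [x^(2M) dx = y^(2M) dy]. *)
Lemma fermat_differential_dy : d y = (x ^+ M) ^+ 2 *: fermat_differential M x y.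
Proof.
have yM : (y ^+ M) ^+ 2 != 0 by rewrite !expf_neq0.
have [dD _ dC] := der_d; have [xyn _ _] := xy_model.
have dxy : d (x ^+ n) = d (y ^+ n).
  have xy1 : x ^+ n + y ^+ n = iota (-1).
    by apply/eqP; rewrite rmorphN rmorph1 -addr_eq0 xyn.
  apply/eqP; rewrite -[d (y ^+ n)]opprK -addr_eq0 -[- d _]scaleN1r.
  by rewrite oppr_pchar2 // scale1r -dD xy1 dC.
rewrite !expr_odd !(derivation_sqrM char_K der_d) in dxy.
rewrite /fermat_differential scalerA mulrC -scalerA dxy scalerA mulVf //.
by rewrite scale1r.
Qed.

(** Both [dx] and [dy] are polynomial multiples of the form; the Leibniz rule does the rest. *)
Lemma derivation_eval2 P :
  exists R,
    d (eval2 iota x y P) = eval2 iota x y R *: fermat_differential M x y.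
Proof.
have [dD dM dC] := der_d.
have dconst c : exists R, d (eval2 iota x y c%:P) =
    eval2 iota x y R *: fermat_differential M x y.
  elim/poly_ind: c => [|c e [R IH]].
    by exists 0; rewrite !eval2_0 (derivation0 der_d) scale0r.
  exists (c%:P * ('X ^+ M) ^+ 2 + 'X%:P * R).
  rewrite polyCD polyCM !(eval2D, eval2_exp, eval2M) eval2_innerX eval2_const.
  rewrite dD dM dC addr0 IH fermat_differential_dx eval2X.
  by rewrite [RHS]scalerDl -!scalerA.
elim/poly_ind: P => [|P c [R IH]].
  by exists 0; rewrite !eval2_0 (derivation0 der_d) scale0r.
have [S dS] := dconst c.
exists (P * ('X%:P ^+ M) ^+ 2 + 'X * R + S).
rewrite !(eval2D, eval2_exp, eval2M) eval2_innerX eval2X.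
by rewrite dD dM IH dS fermat_differential_dy !scalerDl -!scalerA.
Qed.

Section Local.

Variables (a b : K).
Hypothesis ab : a ^+ n + b ^+ n + 1 = 0.

Local Notation regular := (regular_at iota x y a b).

Lemma eval2_neq0_at Q : eval2 idfun a b Q != 0 -> eval2 iota x y Q != 0.
Proof.
apply: contraNneq => Q0.
by rewrite (model_eq_at xy_model (Q := 0) _ ab) ?eval2_0.
Qed.

Lemma regular_atD f g : regular f -> regular g -> regular (f + g).
Proof.
move=> [P1 [Q1 [Q10 ->]]] [P2 [Q2 [Q20 ->]]].
exists (P1 * Q2 + P2 * Q1), (Q1 * Q2); split; first by rewrite eval2M mulf_neq0.
by rewrite eval2D !eval2M addf_div // eval2_neq0_at.
Qed.

Lemma regular_atM f g : regular f -> regular g -> regular (f * g).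
Proof.
move=> [P1 [Q1 [Q10 ->]]] [P2 [Q2 [Q20 ->]]].
exists (P1 * P2), (Q1 * Q2); split; first by rewrite eval2M mulf_neq0.
by rewrite !eval2M mulf_div.
Qed.

Lemma regular_at_derivation g : regular g ->
  exists2 c, regular c & d g = c *: fermat_differential M x y.
Proof.
move=> [P [Q [Q0 gPQ]]]; have Q1 := eval2_neq0_at Q0.
have [[R dP] [S dQ]] := (derivation_eval2 P, derivation_eval2 Q).
exists (eval2 iota x y (R * Q - P * S) / eval2 iota x y (Q ^+ 2)).
  exists (R * Q - P * S), (Q ^+ 2).
  by split=> //; rewrite eval2_exp expf_neq0.
(* [P / Q = Q^-2 (P Q)], where the square stays outside [d]. *)
have gE :
    g = (eval2 iota x y Q)^-1 ^+ 2 * (eval2 iota x y P * eval2 iota x y Q).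
  by rewrite gPQ; field.
have [_ dM _] := der_d.
rewrite gE (derivation_sqrM char_K der_d) dM dP dQ.
have -> : eval2 iota x y P *: (eval2 iota x y S *: fermat_differential M x y) +
    eval2 iota x y Q *: (eval2 iota x y R *: fermat_differential M x y) =
    (eval2 iota x y P * eval2 iota x y S + eval2 iota x y Q * eval2 iota x y R)
      *: fermat_differential M x y by rewrite [RHS]scalerDl -!scalerA.
rewrite scalerA; congr (_ *: _); rewrite eval2_exp eval2B !eval2M exprVn mulrC.
by rewrite oppr_pchar2 // addrC [_ * eval2 _ _ _ R]mulrC.
Qed.

End Local.

Hypothesis dx_neq0 : d x != 0.

Lemma fermat_differential_neq0 : fermat_differential M x y != 0.
Proof.
by apply: contraNneq dx_neq0 => w0; rewrite fermat_differential_dx w0 scaler0.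
Qed.

(** Each [f dh] with [f], [h] regular is a regular multiple of the nonzero form, so [g^2] itself is
    regular at every affine point. *)
Lemma regular_sqr_differential g :
  (forall a b, a ^+ n + b ^+ n + 1 = 0 ->
     exists m (f h : 'I_m -> F),
       [/\ forall l, regular_at iota x y a b (f l),
           forall l, regular_at iota x y a b (h l)
         & g ^+ 2 *: fermat_differential M x y =
             \sum_(l < m) f l *: d (h l)]) ->
  exists2 P : {poly {poly K}}, (size P <= n)%N & g = eval2 iota x y P.
Proof.
move=> reg_w.
apply: (regular_square_polynomial char_K n_odd xy_model) => a b ab.
have [m [f [h [reg_f reg_h wE]]]] := reg_w a b ab.
suff [c reg_c cE] : exists2 c, regular_at iota x y a b c &
    \sum_(l < m) f l *: d (h l) = c *: fermat_differential M x y.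
  suff -> : g ^+ 2 = c by [].
  apply/eqP; rewrite -subr_eq0; have := fermat_differential_neq0.
  apply: contraNT => gc; rewrite -[_ == 0]orFb -(negPf gc) -scaler_eq0.
  by rewrite scalerBl wE cE subrr.
apply: (big_ind (fun w => exists2 c, regular_at iota x y a b c &
    w = c *: fermat_differential M x y)).
- exists 0; last by rewrite scale0r.
  by exists 0, 1; rewrite eval2_0 !eval2_1 mul0r oner_neq0.
- move=> _ _ [c1 r1 ->] [c2 r2 ->]; exists (c1 + c2); last by rewrite scalerDl.
  exact: regular_atD.
move=> l _; have [c rc ->] := regular_at_derivation ab (reg_h l).
by exists (f l * c); [apply: regular_atM | rewrite scalerA].
Qed.

End Kaehler.

End Differential.

(** * Degree bound from two charts, and the count of exponents *)

Section DegreeBound.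

Variables (K F : fieldType) (iota : {rmorphism K -> F}) (n : nat) (x y : F).
Hypotheses (n_gt0 : (0 < n)%N) (xy_model : affine_model iota n x y).
Hypothesis x_neq0 : x != 0.

(** Multiplication by [x^N] turns [x^-i (y/x)^j] into [x^(N-i-j) y^j], of total degree [N - i]. *)
Lemma eval2_invert (P : {poly {poly K}}) :
  exists N, exists2 Q : {poly {poly K}},
    (size Q <= size P)%N /\ (forall i j, Q`_j`_i != 0 -> (i + j <= N)%N) &
    x ^+ N * eval2 iota x^-1 (y / x) P = eval2 iota x y Q.
Proof.
pose N := (\sum_(j < size P) size (P`_j)%R + size P)%N; exists N.
have ltN (j : 'I_(size P)) (i : 'I_(size (P`_j)%R)) : (i + j <= N)%N.
  apply: leq_add; last exact: ltnW.
  by rewrite (bigD1 j) //= (leq_trans (ltnW (ltn_ord i))) ?leq_addr.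
exists (\poly_(j < size P)
  \sum_(i < size (P`_j)%R) P`_j`_i *: 'X^(N - (i + j))).
  split=> [|i j]; first exact: size_poly.
  rewrite coef_poly; case: ltnP => [jP|]; last by rewrite coef0 eqxx.
  apply: contraNT; rewrite -ltnNge => ltN_ij; rewrite coef_sum big1 // => l _.
  rewrite coefZ coefXn; case: eqP => [iE|]; last by rewrite mulr0.
  have := ltN (Ordinal jP) l; rewrite /= => lN.
  by move: ltN_ij; rewrite iE subnDA subnK ?leq_subLR ?leq_addl ?ltnNge
    ?leq_subr // -(leq_add2r l) subnK ?(leq_trans (leq_addr _ _) lN) // addnC.
rewrite (eval2_wide _ _ _ (leqnn _)) mulr_sumr poly_def rmorph_sum /=.
apply: eq_bigr => j _.
rewrite -mul_polyC eval2M eval2_exp eval2X eval2_eval1C rmorph_sum /=.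
rewrite (eval1_wide _ _ (leqnn _)) !mulr_suml mulr_sumr; apply: eq_bigr => i _.
rewrite -mul_polyC eval1M eval1_exp eval1X eval1C.
rewrite -{1}(subnK (ltN j i)) !exprD exprVn expr_div_n.
by field; rewrite !expf_neq0.
Qed.

(** After multiplication by [x^N] both sides have degree below [n] in [Y], so [X^(N+1) P = X^M Q] as
    polynomials. A monomial [(i, j)] of [P] yields [(i + N + 1 - M, j)] in [Q], of total degree at
    most [N]. *)
Lemma two_chart_degree (M : nat) (P P' : {poly {poly K}}) :
  (size P <= n)%N -> (size P' <= n)%N ->
  x * eval2 iota x y P = x ^+ M * eval2 iota x^-1 (y / x) P' ->
  forall i j, P`_j`_i != 0 -> (i + j < M)%N.
Proof.
move=> sP sP' PP'; have [N [Q [sQ degQ] QE]] := eval2_invert P'.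
have E : P * 'X^(N.+1)%:P = Q * 'X^M%:P.
  apply/eqP; rewrite -subr_eq0; apply/eqP/(model_inj n_gt0 xy_model).
    apply/leq_sizeP => j nj; rewrite coefB !coefMC.
    rewrite (nth_default _ (leq_trans sP nj)).
    by rewrite (nth_default _ (leq_trans (leq_trans sQ sP') nj)) !mul0r subrr.
  rewrite eval2B !eval2M -QE !eval2_eval1C !eval1_exp eval1X.
  set g := eval2 _ x y P in PP' *; set h := eval2 _ x^-1 _ P' in PP' *.
  transitivity (x ^+ N * (x * g - x ^+ M * h)); first by rewrite exprS; ring.
  by rewrite PP' subrr mulr0.
move=> i j Pji.
have := congr1 (fun S : {poly {poly K}} => S`_j`_(i + N.+1)) E.
rewrite /= !coefMC !coefMXn ltnNge leq_addl addnK /=.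
case: ltnP => [_ P0|MN /esym QP]; first by rewrite P0 eqxx in Pji.
have /degQ : Q`_j`_(i + N.+1 - M) != 0 by rewrite QP.
by rewrite -(leq_add2r M) addnAC subnK // addnAC addnS -addSn addnC leq_add2l.
Qed.

End DegreeBound.

(** Row [j] has [M - j] pairs, hence [M (M + 1) / 2] in all, and [4 M (M + 1) + 1 = (2 M + 1)^2]. *)
Lemma card_triangle (M : nat) :
  ((#|[set p : 'I_M * 'I_M | p.2 + p.1 < M]| * 8).+1 = M.*2.+1 ^ 2)%N.
Proof.
have row (j : 'I_M) : (\sum_(i < M) (i + j < M : nat) = M - j)%N.
  rewrite -[RHS]muln1 -[in RHS](card_ord (M - j)) -sum_nat_const.
  rewrite (big_ord_widen M (fun=> 1%N)) ?leq_subr // [RHS]big_mkcond /=.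
  by apply: eq_bigr => i _; rewrite ltn_subRL addnC; case: ifP.
have -> : #|[set p : 'I_M * 'I_M | (p.2 + p.1 < M)%N]| =
    (\sum_(j < M) (M - j))%N.
  rewrite -sum1_card big_mkcond /= -(eq_bigr _ (fun j _ => row j)) pair_bigA.
  by apply: eq_bigr => p _; rewrite inE; case: ifP.
have S : ((\sum_(j < M) (M - j)) * 2 = M * M.+1)%N.
  elim: M {row} => [|M IH]; first by rewrite big_ord0.
  rewrite big_ord_recl /= mulnDl subn0 (eq_bigr (fun j : 'I_M => M - j)%N) //.
  by rewrite IH [(M * _)%N]mulnC -mulnDr add2n.
have -> : 8%N = (2 * 4)%N by [].
by rewrite mulnA S -muln2 expnS expn1; ring.
Qed.

(** * The space of exact holomorphic differentials *)

Section RegularFunctions.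

Variables (K F : fieldType) (iota : {rmorphism K -> F}) (xi : 'I_3 -> F).
Variable v : 'I_3 -> K.

Local Notation regular := (regular_function_at iota xi v).

Lemma regular_const c : regular (iota c).
Proof.
exists 0%N, c%:MP, 1.
split; rewrite ?dhomog1 ?rmorph1 ?oner_neq0 ?mmapC ?divr1 //.
by rewrite -[c%:MP]mulr1 mul_mpolyC dhomogZ ?dhomog1.
Qed.

Lemma regularM f g : regular f -> regular g -> regular (f * g).
Proof.
move=> [e1 [A1 [B1 [hA1 hB1 B10 ->]]]] [e2 [A2 [B2 [hA2 hB2 B20 ->]]]].
exists (e1 + e2)%N, (A1 * A2), (B1 * B2).
split; rewrite ?dhomogM // ?mevalM ?mulf_neq0 //.
by rewrite !(rmorphM (mmap iota xi)) mulf_div.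
Qed.

Lemma regularX f m : regular f -> regular (f ^+ m).
Proof.
move=> rf; elim: m => [|m IH]; last by rewrite exprS; apply: regularM.
by rewrite expr0 -(rmorph1 iota); apply: regular_const.
Qed.

Lemma regular_ratio k l : v l != 0 -> regular (xi k / xi l).
Proof.
by exists 1%N, 'X_k, 'X_l; split; rewrite ?homog_mpolyX ?mevalXU ?mmap_mpolyX.
Qed.

End RegularFunctions.

(** * The explicit basis, read in two charts *)

Section FermatCurve.

Variables (K : closedFieldType) (F : fieldType) (iota : {rmorphism K -> F}).
Variables (M : nat) (xi : 'I_3 -> F).
Hypothesis char_K : 2%N \in [pchar K].

Notation n := (M.*2.+1).

Hypothesis F_fun : is_function_field iota (fermat_form K n) xi.
Variables (Om : lmodType F) (d : F -> Om).
Hypothesis kaehler : is_kaehler iota d.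

Let char_F : 2%N \in [pchar F] := rmorph_pchar iota char_K.

Let der_d : is_derivation iota d. Proof. by case: kaehler. Qed.

(** Two vanishing coordinates would force the third to vanish. *)
Lemma curve_point_coord_neq0 (v : 'I_3 -> K) i j k : uniq [:: i; j; k] ->
  curve_point (fermat_form K n) v -> v i = 0 -> v j != 0.
Proof.
move=> ijk [[l vl]]; rewrite (meval_fermat_form _ _ ijk) => + vi0.
apply: contra_eq_neq => vj0.
rewrite vi0 vj0 !expr0n !add0r expf_eq0 /=.
by case: (ord3_cases ijk l) vl => ->; rewrite ?vi0 ?vj0 ?eqxx.
Qed.

Section Chart.

Variables (i j k : 'I_3).
Hypothesis ijk : uniq [:: i; j; k].

Let x := xi i / xi k.
Let y := xi j / xi k.
Let s := xi k / xi i.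
Let t := xi j / xi i.

Local Notation omega := (fermat_differential d M).

Let xik0 l : xi l != 0. Proof. exact: generic_coord_neq0 F_fun l. Qed.

Let n_gt0 : (0 < n)%N. Proof. by []. Qed.

Let xy_model : affine_model iota n x y.
Proof. exact (generic_affine_model char_K F_fun ijk). Qed.

Let kji : uniq [:: k; j; i].
Proof. by rewrite -rev_uniq. Qed.

Let st_model : affine_model iota n s t.
Proof. exact (generic_affine_model char_K F_fun kji). Qed.

Let sE : s = x^-1. Proof. by rewrite invf_div. Qed.

Let tE : t = y / x. Proof. by rewrite /t /y /x; field; rewrite !xik0. Qed.

Let x_neq0 : x != 0. Proof. by rewrite mulf_neq0 ?invr_eq0. Qed.

Let y_neq0 : y != 0. Proof. by rewrite mulf_neq0 ?invr_eq0. Qed.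

(** The universal property sends [dx] to [D x = 1]. *)
Lemma generic_dx_neq0 : d x != 0.
Proof.
have sep_x := generic_coord_not_square char_K F_fun ijk.
have [D derD Dx] := derivation_exists char_K xy_model sep_x.
have [_ /(_ _ D derD)[phi [Dphi _]]] := kaehler.
apply: contraTneq (oner_neq0 F) => dx0; rewrite negbK.
by rewrite -Dx Dphi dx0 linear0.
Qed.

Let dx_inv : d x = s ^- 2 *: d s.
Proof. by rewrite -(derivation_inv char_K der_d) sE invrK. Qed.

(** From [dx = s^-2 ds] and [y = t / s]. The factor [s^(M-1)] is written [s ^+ M / s] because [M]
    may be 0. *)
Lemma omega_chart_change : omega x y = (s ^+ M / s) ^+ 2 *: omega s t.
Proof.
rewrite /fermat_differential dx_inv !scalerA; congr (_ *: _).
have s0 : s != 0 by rewrite sE invr_eq0.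
have -> : y = t / s by rewrite tE sE invrK divfK.
have t0 : t != 0 by rewrite tE mulf_neq0 // invr_eq0.
by rewrite expr_div_n; field; rewrite ?expf_neq0 ?s0 ?t0.
Qed.

Lemma omega_swap : omega x y = (x ^+ M) ^- 2 *: d y.
Proof.
rewrite (fermat_differential_dy char_K xy_model der_d) scalerA mulVf.
  by rewrite scale1r.
by rewrite !expf_neq0.
Qed.

(** Regularity in the first chart makes [g] a polynomial in [x], [y]; in the second it makes
    [g s^(M-1)] a polynomial in [1/x], [y/x]. [two_chart_degree] compares them. *)
Lemma holomorphic_sqr_polynomial g :
  holomorphic iota (fermat_form K n) xi d (g ^+ 2 *: omega x y) ->
  exists2 P : {poly {poly K}},
    (forall l m, P`_m`_l != 0 -> (l + m < M)%N) & g = eval2 iota x y P.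
Proof.
move=> hol.
have ds_neq0 : d s != 0.
  have := generic_dx_neq0; rewrite dx_inv.
  by apply: contraNneq => ->; rewrite scaler0.
have [P sP gP] : exists2 P : {poly {poly K}},
    (size P <= n)%N & g = eval2 iota x y P.
  apply: (regular_sqr_differential char_K xy_model der_d generic_dx_neq0).
  move=> a b ab; have := hol _ (affine_curve_point ijk ab).
  move=> [m [f [h [rf rh wE]]]]; exists m, f, h; split=> // l.
    exact: (regular_function_chart char_K F_fun ijk (rf l)).
  exact: (regular_function_chart char_K F_fun ijk (rh l)).
have [P' sP' gP'] : exists2 P' : {poly {poly K}},
    (size P' <= n)%N & g * (s ^+ M / s) = eval2 iota s t P'.
  apply: (regular_sqr_differential char_K st_model der_d ds_neq0).
  move=> a b ab; have := hol _ (affine_curve_point kji ab).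
  move=> [m [f [h [rf rh wE]]]]; exists m, f, h; split=> [l|l|].
  - exact: (regular_function_chart char_K F_fun kji (rf l)).
  - exact: (regular_function_chart char_K F_fun kji (rh l)).
  by rewrite exprMn -scalerA -omega_chart_change.
exists P => // l m; apply: (two_chart_degree n_gt0 xy_model x_neq0 sP sP').
rewrite -gP -tE -sE -gP' sE exprVn.
by field; rewrite x_neq0 oner_neq0 expf_neq0.
Qed.

(** The first index is the exponent of [y], matching the outer variable of [{poly {poly K}}]. *)
Definition monomial (p : 'I_M * 'I_M) : F := x ^+ p.2 * y ^+ p.1.

(** The local form is [ds] if [v k = 0], [dy] if [v j = 0], and [dx] otherwise. [z] is chosen before
    [p], so that combinations of monomials share one [dz]. *)
Lemma monomial_regular (v : 'I_3 -> K) : curve_point (fermat_form K n) v ->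
  exists2 z, regular_function_at iota xi v z &
    forall p : 'I_M * 'I_M, (p.2 + p.1 < M)%N ->
      exists2 r, regular_function_at iota xi v r &
        monomial p ^+ 2 *: omega x y = r ^+ 2 *: d z.
Proof.
move=> Cv; have [vk0 | vk] := eqVneq (v k) 0.
  have vi : v i != 0.
    by apply: (curve_point_coord_neq0 (i := k) (k := j)) Cv vk0;
      move: ijk; rewrite /= !inE !(eq_sym k) !(eq_sym j); do !case: eqP.
  have vj : v j != 0 by apply: (curve_point_coord_neq0 kji).
  exists s; first exact: regular_ratio.
  (* [x^l y^m s^(M-1) = s^(M-1-l-m) t^m]: the bound [l + m < M] rules out a pole at [s = 0], and [t]
     is invertible because [v j] is nonzero. *)
  move=> p pM; exists (s ^+ (M - (p.2 + p.1).+1) * t ^+ p.1 * (t^-1) ^+ M).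
    apply: regularM; first apply: regularM; apply: regularX.
    - exact: regular_ratio.
    - exact: regular_ratio.
    - by rewrite invf_div; apply: regular_ratio.
  rewrite omega_chart_change /fermat_differential !scalerA; congr (_ *: _).
  rewrite /monomial -exprVn -!exprMn; congr (_ ^+ 2).
  have s0 : s != 0 by rewrite sE invr_eq0.
  have -> : y = t / s by rewrite tE sE invrK divfK.
  have -> : x = s^-1 by rewrite sE invrK.
  have -> : s ^+ M = s ^+ (M - (p.2 + p.1).+1) * (s ^+ p.2 * s ^+ p.1 * s).
    by rewrite -exprD -exprSr -exprD subnK.
  rewrite expr_div_n !exprVn; field.
  by rewrite !expf_neq0 ?s0 // tE mulf_neq0 // invr_eq0.
have [vj0 | vj] := eqVneq (v j) 0.
  have vi : v i != 0.
    by apply: (curve_point_coord_neq0 (i := j) (k := k)) Cv vj0;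
      move: ijk; rewrite /= !inE !(eq_sym j) !(eq_sym k); do !case: eqP.
  exists y; first exact: regular_ratio.
  move=> p pM; exists (monomial p * (x^-1) ^+ M).
    apply: regularM; last first.
      by apply: regularX; rewrite invf_div; apply: regular_ratio.
    by apply: regularM; apply: regularX; apply: regular_ratio.
  by rewrite omega_swap scalerA -exprVn -exprMn exprVn.
exists x; first exact: regular_ratio.
move=> p pM; exists (monomial p * (y^-1) ^+ M).
  apply: regularM; last first.
    by apply: regularX; rewrite invf_div; apply: regular_ratio.
  by apply: regularM; apply: regularX; apply: regular_ratio.
by rewrite scalerA -exprVn -exprMn exprVn.
Qed.

Let A := [set p : 'I_M * 'I_M | (p.2 + p.1 < M)%N].

Let mono (l : 'I_#|A|) : F := monomial (enum_val l).

Lemma sqr_sum m (u : 'I_m -> F) :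
  (\sum_(l < m) u l) ^+ 2 = \sum_(l < m) u l ^+ 2.
Proof.
apply: (big_morph (fun z => z ^+ 2)); last by rewrite expr0n.
by move=> a b; apply: sqrrD_pchar2.
Qed.

Lemma sqrt_family m (c : 'I_m -> K) :
  exists e : 'I_m -> K, forall l, c l = e l ^+ 2.
Proof. exact: (fin_all_exists (fun l => sqrt_exists (c l))). Qed.

(** Squaring is additive. With [sqrt_family] this identifies [K]-combinations of squared monomials
    with squares of [K]-combinations. *)
Lemma sqr_mono_combination (e : 'I_#|A| -> K) :
  \sum_l iota (e l ^+ 2) * mono l ^+ 2 = (\sum_l iota (e l) * mono l) ^+ 2.
Proof.
by rewrite sqr_sum; apply: eq_bigr => l _; rewrite [RHS]exprMn rmorphXn.
Qed.

(** Exponents of [y] are below [M], hence below [n], so [model_inj] turns the relation into an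
    identity of polynomials. *)
Lemma mono_free (e : 'I_#|A| -> K) :
  \sum_l iota (e l) * mono l = 0 -> forall l, e l = 0.
Proof.
move=> sum0 l0.
pose P : {poly {poly K}} :=
  \sum_(l < #|A|) (e l *: 'X^((enum_val l).2))%:P * 'X^((enum_val l).1).
have P0 : P = 0.
  apply: (model_inj n_gt0 xy_model).
    apply: (leq_trans (size_sum _ _ _)); apply/bigmax_leqP => l _.
    rewrite mul_polyC (leq_trans (size_scale_leq _ _)) // size_polyXn ltnS.
    by rewrite ltnW // -addnn ltn_addl // ltn_ord.
  rewrite -[RHS]sum0 rmorph_sum; apply: eq_bigr => l _ /=.
  rewrite eval2M eval2_exp eval2X eval2_eval1C -mul_polyC eval1M eval1_exp.
  by rewrite eval1X eval1C -mulrA.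
have := congr1
  (fun S : {poly {poly K}} => S`_(enum_val l0).1`_(enum_val l0).2) P0.
rewrite /= !coef0 coef_sum coef_sum (bigD1 l0) //= big1 ?addr0 => [|l ll0].
  by rewrite coefCM coefXn eqxx mulr1 coefZ coefXn eqxx mulr1.
rewrite coefCM coefXn; case: eqP => [E1|_]; last by rewrite mulr0 coef0.
rewrite mulr1 coefZ coefXn; case: eqP => [E2|_]; last by rewrite mulr0.
case/eqP: ll0; apply: enum_val_inj.
case: (enum_val l) (enum_val l0) E1 E2 => [a b] [a' b'] /=.
by move=> /val_inj -> /val_inj ->.
Qed.

Lemma mono_span (P : {poly {poly K}}) :
  (forall l m, P`_m`_l != 0 -> (l + m < M)%N) ->
  exists e : 'I_#|A| -> K, eval2 iota x y P = \sum_l iota (e l) * mono l.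
Proof.
move=> degP; exists (fun l : 'I_#|A| => P`_(enum_val l).1`_(enum_val l).2).
have P0 l m : (M <= l + m)%N -> P`_m`_l = 0.
  by rewrite leqNgt; apply: contraNeq => /degP.
have sPm m : (size (P`_m)%R <= M)%N.
  by apply/leq_sizeP => l Ml; apply: P0; apply: leq_trans (leq_addr _ _).
have sP : (size P <= M)%N.
  apply/leq_sizeP => m Mm; apply/polyP => l; rewrite coef0.
  by apply: P0; apply: leq_trans (leq_addl _ _).
rewrite (eval2_wide _ _ _ sP).
rewrite -(big_enum_val (fun p : 'I_M * 'I_M => iota P`_p.1`_p.2 * monomial p)).
transitivity (\sum_(m < M) \sum_(l < M) iota P`_m`_l * (x ^+ l * y ^+ m)).
  apply: eq_bigr => m _; rewrite (eval1_wide _ _ (sPm m)) mulr_suml.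
  by apply: eq_bigr => l _; rewrite mulrA.
rewrite pair_bigA /= [RHS]big_mkcond; apply: eq_bigr => p _.
by rewrite inE; case: ltnP => // /P0 ->; rewrite rmorph0 mul0r.
Qed.

(** The condition [u 1 dz = 0] leaves [w = (u 0)^2 dz], and [z = p^2 + q^2 x] gives
    [dz = q^2 dx = (q y^M)^2 omega]. *)
Lemma cartier_kernel w : cartier 2 d w 0 -> exists g, w = g ^+ 2 *: omega x y.
Proof.
case=> z [u [_ -> /esym u1]].
have [p [q zE]] := sqr_combination_all char_K xy_model z.
exists (u 0%N * q * y ^+ M).
have dz : d z = q ^+ 2 *: d x.
  have [dD _ _] := der_d.
  rewrite zE dD (derivation_sqr char_K der_d) add0r.
  exact: (derivation_sqrM char_K der_d).
rewrite big_ord_recl big_ord1 scalerDl expr0 mulr1.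
rewrite [X in _ + X](_ : _ = 0) ?addr0.
  rewrite dz (fermat_differential_dx xy_model d) !scalerA.
  by rewrite !exprMn.
by rewrite /= -[u _ ^+ 2 * _]mulrAC -scalerA u1 scaler0.
Qed.

Lemma fermat_a_number : has_a_number 2 iota (fermat_form K n) xi d #|A|.
Proof.
exists (fun l => mono l ^+ 2 *: omega x y); split=> [c sum0 l|w].
  (* Square roots of the coefficients turn the relation into the vanishing of a square. *)
  have [e cE] := sqrt_family c.
  have omega0 := fermat_differential_neq0 xy_model generic_dx_neq0.
  have {}sum0 : (\sum_m iota (e m ^+ 2) * mono m ^+ 2) *: omega x y = 0.
    rewrite scaler_suml -[RHS]sum0; apply: eq_bigr => m _.
    by rewrite -scalerA -cE.
  rewrite cE (mono_free (e := e)) ?expr0n //; apply/eqP.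
  move/eqP: sum0; rewrite scaler_eq0 (negPf omega0) orbF sqr_mono_combination.
  by rewrite sqrf_eq0.
split=> [[hol /cartier_kernel[g wE]]|[c wE]].
  have [|P degP gP] := @holomorphic_sqr_polynomial g; first by rewrite -wE.
  have [e eP] := mono_span degP.
  exists (fun l => e l ^+ 2).
  rewrite wE gP eP -sqr_mono_combination scaler_suml.
  by apply: eq_bigr => l _; rewrite scalerA.
split=> [v /monomial_regular[z rz mono_r]|].
  have [r rP] : exists r : 'I_#|A| -> F, forall l,
      regular_function_at iota xi v (r l) /\
      mono l ^+ 2 *: omega x y = r l ^+ 2 *: d z.
    apply: (@fin_all_exists _ _ (fun l r => regular_function_at iota xi v r /\
      mono l ^+ 2 *: omega x y = r ^+ 2 *: d z)) => l.
    have [|r rr E] := mono_r (enum_val l); last by exists r.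
    by have := enum_valP l; rewrite inE.
  exists #|A|, (fun l => iota (c l) * r l ^+ 2), (fun=> z); split=> // [l|].
    apply: regularM; first exact: regular_const.
    by apply: regularX; case: (rP l).
  rewrite wE; apply: eq_bigr => l _.
  by have [_ ->] := rP l; rewrite scalerA.
have [e cE] := sqrt_family c.
(* With [t = x], dividing by [y^M] accounts for the denominator of [omega], and [u 1 = 0] makes the
   Cartier image 0. *)
exists x, (fun m =>
  if m == 0%N then (\sum_l iota (e l) * mono l) / y ^+ M else 0).
split; first exact (generic_coord_not_square char_K F_fun ijk).
  rewrite big_ord_recl big_ord1 /= expr0 mulr1 expr0n mul0r addr0 wE.
  rewrite expr_div_n -scalerA -/(omega x y) -sqr_mono_combination scaler_suml.
  by apply: eq_bigr => l _; rewrite scalerA -cE.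
by rewrite /= scale0r.
Qed.

End Chart.

End FermatCurve.

Theorem theorem5p1 (K : closedFieldType) (char_K : 2%N \in [pchar K])
    (n : nat) (n_gt0 : (0 < n)%N) (n_odd : ~~ (2 %| n)%N)
    (F : fieldType) (iota : {rmorphism K -> F}) (xi : 'I_3 -> F)
    (F_fun : is_function_field iota (fermat_form K n) xi)
    (Om : lmodType F) (d : F -> Om) (Om_kaehler : is_kaehler iota d) :
  exists a : nat,
    has_a_number 2 iota (fermat_form K n) xi d a /\
    a%:R = 1 / 8%:R * (n%:R ^+ 2 - 1) :> rat.
Proof.
have nE : n = n./2.*2.+1.
  by rewrite -[LHS]odd_double_half; move: n_odd; rewrite dvdn2 negbK => ->.
move: F_fun; rewrite nE; set M := n./2 => F_fun'.
exists #|[set p : 'I_M * 'I_M | (p.2 + p.1 < M)%N]|; split.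
  have u : uniq [:: 0; 1; 2%:R : 'I_3] by [].
  exact (fermat_a_number char_K F_fun' Om_kaehler u).
have -> : M.*2.+1%:R ^+ 2 - 1 =
    (#|[set p : 'I_M * 'I_M | (p.2 + p.1 < M)%N]| * 8)%:R :> rat.
  by rewrite -natrX -card_triangle -natr1 addrK.
by rewrite natrM mulrCA mul1r mulVf ?mulr1 // pnatr_eq0.
Qed.
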